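(* Let $m\ge1$ and $\kappa_m=\sqrt{\ln(4m)/\pi}$. The average number of nodes of the minimal dag of an $m$-labeled unranked tree of size $n$, taken uniformly at random, satisfies $$\bar N^{\mathcal T}_{m,n}=\kappa_m\frac{n}{\sqrt{\ln n}}\left(1+O\!\left(\frac1{\ln n}\right)\right)\quad(n\to\infty).$$
   Context: An $m$-labeled unranked tree is a non-empty finite rooted tree with node labels in $\{1,\dots,m\}$ and linearly ordered children (any finite number); its size is its number of edges. The number of nodes of its minimal dag is the number of distinct subtrees (subtree = a node with all its descendants, compared as ordered labeled trees). $\bar N^{\mathcal T}_{m,n}$ is the average of this quantity over all $m$-labeled unranked trees of size $n$. *)

(* Defs.v *)
From HB Require Import structures.
From mathcomp Require Import all_boot all_order all_algebra.
From mathcomp Require Import all_classical all_reals all_analysis.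
Set Implicit Arguments. Unset Strict Implicit. Unset Printing Implicit Defensive.
Import Order.TTheory GRing.Theory Num.Theory.

Inductive tree : Type := Node of nat & seq tree.

Fixpoint tree_to_gen (t : tree) : GenTree.tree unit :=
  match t with Node a ts => GenTree.Node a (map tree_to_gen ts) end.

Fixpoint gen_to_tree (g : GenTree.tree unit) : tree :=
  match g with
  | GenTree.Leaf _ => Node 0 [::]
  | GenTree.Node a gs => Node a (map gen_to_tree gs)
  end.

Lemma tree_to_genK : cancel tree_to_gen gen_to_tree.
Proof.
unfold cancel. fix IH 1. intros [a ts]. simpl. f_equal.
induction ts as [|t ts IHts]; [reflexivity|]. simpl. rewrite IH. now rewrite IHts.
Qed.

HB.instance Definition _ := Countable.copy tree (can_type tree_to_genK).

(* number of nodes; the size of a tree is its number of edges = nodes - 1 *)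
Fixpoint nnodes (t : tree) : nat :=
  match t with Node _ ts => (sumn (map nnodes ts)).+1 end.
Definition tsize (t : tree) : nat := (nnodes t).-1.

Fixpoint labeled_in (m : nat) (t : tree) : bool :=
  match t with Node a ts => (1 <= a <= m) && all (labeled_in m) ts end.

Fixpoint subtrees (t : tree) : seq tree :=
  match t with Node _ ts => t :: flatten (map subtrees ts) end.

(* number of nodes of the minimal dag = number of distinct subtrees *)
Definition dag_nodes (t : tree) : nat := size (undup (subtrees t)).

Definition mtrees (m n : nat) : set tree :=
  [set t | labeled_in m t /\ tsize t = n].

Local Open Scope ring_scope.
(* average number of nodes of the minimal dag over all m-labeled unranked trees
   of size n (a finite, nonempty set for m >= 1). *)
Definition avg_dag_nodes (R : realType) (m n : nat) : R :=
  (\sum_(t \in mtrees m n) ((dag_nodes t)%:R : R)) /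
  (\sum_(t \in mtrees m n) (1 : R)).

Definition kappa (R : realType) (m : nat) : R := Num.sqrt (ln (4 * m%:R) / pi).

(* Main.v *)
Require Import Defs.
From mathcomp Require Import all_boot all_order all_algebra.
From mathcomp Require Import all_classical all_reals all_analysis.
From mathcomp Require Import ring lra zify.
Import Order.TTheory GRing.Theory Num.Theory.
Import numFieldNormedType.Exports.
(* mathcomp's tuple library has its own [tsize]. *)
Import Defs.
Local Open Scope ring_scope.

(** First and second moments.  Detaching the first child of the root splits a
    tree with n+1 edges into two trees with n edges in total, so the number
    t_n = m^(n+1) C_n of trees, the total number of proper occurrences of a fixed
    tree s of size k, and the total number of ordered pairs of such occurrences
    all satisfy Catalan-like convolution recurrences, solved in closed form (for
    the pairs: bounded) in terms of b_j = 'C(2j, j) / 4^j.  Since the number of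
    distinct subtrees counts each s at most once, and at least X - X(X-1)/2 times
    if s occurs X times, summing over all s of size at least K gives n b_K up to
    O(n b_K / K), where K is the integer part of log_{4m} n: there are at most t_K
    trees of size less than K, and pairs of equal subtrees of size at least K are
    rare.  The sums over k telescope because C_k / 4^k = 2 (b_k - b_{k+1}).
    Finally b_K = (pi K)^(-1/2) (1 + O(1/K)) by Wallis. *)

(** * Normalized central binomial coefficients *)

Lemma conv_rev (R : comNzRingType) (F G : nat -> R) (n : nat) :
  \sum_(i < n.+1) F i * G (n - i)%N = \sum_(i < n.+1) F (n - i)%N * G i.
Proof.
rewrite (reindex_inj rev_ord_inj) /=; apply: eq_bigr => i _.
by rewrite subSS subKn // -ltnS.
Qed.

Section CentralBinomial.
Context (R : realFieldType).

(* [ncb n] is 'C(2n, n) / 4 ^ n, and [nct n] is C_n / 4 ^ n with C_n the Catalan number. *)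
Fixpoint ncb (n : nat) : R :=
  if n is k.+1 then ncb k * ((2 * k%:R + 1) / (2 * k%:R + 2)) else 1.

Arguments ncb : simpl never.

Definition nct (n : nat) : R := ncb n / n.+1%:R.

Lemma ncb0 : ncb 0 = 1. Proof. by []. Qed.

Lemma ncb_rec (n : nat) : (2 * n%:R + 2) * ncb n.+1 = (2 * n%:R + 1) * ncb n.
Proof.
have n0 : (0 : R) <= n%:R by [].
by rewrite [ncb n.+1]/ncb -/ncb; field; rewrite lt0r_neq0 //; lra.
Qed.

Lemma ncb_gt0 (n : nat) : 0 < ncb n.
Proof.
elim: n => [|n IH]; first exact: ltr01.
rewrite [ncb n.+1]/ncb -/ncb; have n0 : (0 : R) <= n%:R by [].
by rewrite mulr_gt0 // divr_gt0 //; lra.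
Qed.

Lemma nct_gt0 (n : nat) : 0 < nct n.
Proof. by rewrite divr_gt0 ?ncb_gt0. Qed.

Lemma nctE (n : nat) : nct n = 2 * (ncb n - ncb n.+1).
Proof.
have n0 : (0 : R) <= n%:R by [].
rewrite /nct [ncb n.+1]/ncb -/ncb -natr1; field; rewrite !lt0r_neq0 //; lra.
Qed.

Lemma mul_nct (n : nat) : n.+1%:R * nct n = ncb n.
Proof. by rewrite /nct; field. Qed.

Lemma nct0 : nct 0 = 1. Proof. by rewrite /nct ncb0 divr1. Qed.

Lemma nct_rec (n : nat) : (2 * n%:R + 4) * nct n.+1 = (2 * n%:R + 1) * nct n.
Proof.
have := ncb_rec n; rewrite -!mul_nct -[n.+2%:R]natr1 -[n.+1%:R]natr1 => E.
by apply: (@mulfI _ (n%:R + 1)); [rewrite natr1 pnatr_eq0|lra].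
Qed.

Lemma ncb_nonincreasing (m n : nat) : (m <= n)%N -> ncb n <= ncb m.
Proof.
elim: n => [|n IH]; first by rewrite leqn0 => /eqP->.
rewrite leq_eqVlt => /predU1P[->//|]; rewrite ltnS => /IH; apply: le_trans.
by have := nct_gt0 n; rewrite nctE; lra.
Qed.

Lemma nct_nonincreasing (m n : nat) : (m <= n)%N -> nct n <= nct m.
Proof.
move=> mn; rewrite ler_pM ?ncb_nonincreasing ?invr_ge0 ?(ltW (ncb_gt0 _)) //.
by rewrite lef_pV2 ?posrE // ler_nat.
Qed.

Lemma sum_ncb (n : nat) : \sum_(i < n) ncb i = 2 * n%:R * ncb n.
Proof.
elim: n => [|n IH]; first by rewrite big_ord0 mulr0 mul0r.
rewrite big_ord_recr /= IH -natr1; have := ncb_rec n; lra.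
Qed.

(** By [sum_ncb], twice each side is a partial sum of the positive sequence [ncb]. *)
Lemma mul_ncb_nondecreasing (m n : nat) : (m <= n)%N -> m%:R * ncb m <= n%:R * ncb n.
Proof.
move=> mn; rewrite -(@ler_pM2l _ 2) // !mulrA -!sum_ncb -(subnKC mn) big_split_ord /=.
by rewrite lerDl sumr_ge0 // => i _; exact/ltW/ncb_gt0.
Qed.

(** Symmetrization: under the exchange of [i] and [n - i] the weight [i] averages to [n / 2]. *)
Lemma mul_ncb_conv (n : nat) :
  \sum_(i < n.+1) i%:R * ncb i * ncb (n - i) =
  n%:R * (\sum_(i < n.+1) ncb i * ncb (n - i)) / 2.
Proof.
set M := LHS; suff: M + M = n%:R * (\sum_(i < n.+1) ncb i * ncb (n - i)) by lra.
rewrite {2}/M (conv_rev _ (fun i => i%:R * ncb i)) -big_split mulr_sumr.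
apply: eq_bigr => -[i /= ltin] _.
have -> : n%:R = i%:R + (n - i)%:R :> R by rewrite -natrD subnKC.
ring.
Qed.

(** Coefficient form of the fact that (1 - x)^(-1/2) squares to 1 / (1 - x). In the induction step
    the convolution weighted by [i] is evaluated twice, by symmetry and by [ncb_rec]. *)
Lemma ncb_conv (n : nat) : \sum_(i < n.+1) ncb i * ncb (n - i) = 1.
Proof.
elim: n => [|n IH]; first by rewrite big_ord1 mulr1.
have shift : \sum_(i < n.+2) i%:R * ncb i * ncb (n.+1 - i) =
    \sum_(i < n.+1) (i%:R * ncb i * ncb (n - i) + 2^-1 * (ncb i * ncb (n - i))).
  rewrite big_ord_recl !mul0r add0r; apply: eq_bigr => i _.
  rewrite lift0 subSS [X in X * _ = _](_ : _ = (i%:R + 2^-1) * ncb i); first ring.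
  by rewrite -natr1; have := ncb_rec i; lra.
have n0 : n.+1%:R != 0 :> R by rewrite pnatr_eq0.
move: shift; rewrite big_split /= -mulr_sumr !mul_ncb_conv IH => shift.
by apply: (mulfI n0); move: shift; rewrite -natr1; lra.
Qed.

(** By [nctE] this is twice the difference of the [ncb] convolutions at [n] and [n.+1]; both equal
    1, but the second lacks its last term [ncb n.+1]. *)
Lemma nct_ncb_conv (n : nat) : \sum_(i < n.+1) ncb i * nct (n - i) = 2 * ncb n.+1.
Proof.
have := ncb_conv n.+1; rewrite big_ord_recr /= subnn mulr1 => E.
under eq_bigr => i _ do
  rewrite nctE mulrCA mulrBr -(subSn (leq_ord i)).
rewrite -mulr_sumr sumrB ncb_conv.
by rewrite -[X in 1 - X]/(\sum_(i < n.+1) ncb i * ncb (n.+1 - i)); move: E => /=; lra.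
Qed.

(** Segner's recurrence for the Catalan numbers; the 4 comes from the normalization by [4 ^ n]. *)
Lemma nct_conv (n : nat) : \sum_(i < n.+1) nct i * nct (n - i) = 4 * nct n.+1.
Proof.
set S := \sum_(i < n.+1) ncb i.+1 * nct (n - i).
have shift : nct n.+1 + S = 2 * ncb n.+2.
  by rewrite -nct_ncb_conv big_ord_recl mul1r subn0.
have -> : \sum_(i < n.+1) nct i * nct (n - i) = 2 * (2 * ncb n.+1 - S).
  rewrite /S -nct_ncb_conv -sumrB mulr_sumr; apply: eq_bigr => i _.
  by rewrite [nct i]nctE; ring.
by move: shift; have := nctE n.+1; lra.
Qed.

(** Serves to solve the recurrence for pairs of occurrences in [sum_occ_pairs_le]. *)
Lemma mul_ncb_nct_conv (n : nat) :
  \sum_(i < n.+1) i%:R * ncb i * nct (n - i) = 2 * n.+1%:R * ncb n.+1 - 1.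
Proof.
have E : \sum_(i < n.+1) i%:R * ncb i * ncb (n.+1 - i) = n.+1%:R / 2 - n.+1%:R * ncb n.+1.
  apply: (addIr (n.+1%:R * ncb n.+1)); rewrite subrK.
  have := mul_ncb_conv n.+1; rewrite ncb_conv mulr1 => <-.
  by rewrite [RHS]big_ord_recr /= subnn mulr1.
under eq_bigr => i _ do
  rewrite nctE mulrCA mulrBr -(subSn (leq_ord i)).
by rewrite -mulr_sumr sumrB mul_ncb_conv ncb_conv E -[n.+1%:R]natr1; lra.
Qed.

End CentralBinomial.

Arguments ncb : simpl never.

(** * Wallis bounds *)

Section Wallis.
Context (R : realType).

(* The recursion is integration by parts. *)
Fixpoint sinX_prim (n : nat) : R -> R :=
  match n with
  | 0 => id
  | 1 => fun x => - cos x
  | k.+2 => fun x => (k.+1%:R * sinX_prim k x - sin x ^+ k.+1 * cos x) / k.+2%:R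
  end.

(** Two consecutive exponents are treated together because the recursion steps by two. *)
Lemma is_derive_sinX_prim (n : nat) (x : R) :
  is_derive x 1 (sinX_prim n) (sin x ^+ n) /\
  is_derive x 1 (sinX_prim n.+1) (sin x ^+ n.+1).
Proof.
elim: n => [|n [IH1 IH2]].
  split; first by rewrite expr0; exact: is_derive_id.
  have -> : sinX_prim 1 = - (@cos R) by [].
  by rewrite expr1 -[sin x]opprK; exact: is_deriveN.
split=> //.
have -> : sinX_prim n.+2 = (n.+2%:R)^-1 *:
    (n.+1%:R *: sinX_prim n - ((@sin R) ^+ n.+1) * (@cos R)).
  by apply/funext => y; rewrite exprfctE; exact: mulrC.
have dS := is_deriveX n.+1 (is_derive_sin x).
have dM := is_deriveM dS (is_derive_cos x).
have dB := is_deriveB (is_deriveZ n.+1%:R IH1) dM.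
apply: is_derive_eq (is_deriveZ _ dB) _.
rewrite exprfctE /GRing.scale /= -[n.+2%:R]natr1 -[n.+1%:R]natr1 !exprS.
have n0 : (0 : R) <= n%:R by [].
rewrite [cos x * _](_ : _ = (n%:R + 1) * sin x ^+ n * cos x ^+ 2); last by ring.
by rewrite cos2sin2; field; apply/lt0r_neq0; lra.
Qed.

Lemma sinX_prim_le (n : nat) :
  sinX_prim n.+1 (pi / 2) - sinX_prim n.+1 0 <= sinX_prim n (pi / 2) - sinX_prim n 0.
Proof.
have h0 : (0 : R) <= pi / 2 by rewrite divr_ge0 ?pi_ge0.
have D (x : R) : is_derive x 1 (sinX_prim n - sinX_prim n.+1 : R -> R) (sin x ^+ n - sin x ^+ n.+1).
  by have [? ?] := is_derive_sinX_prim n x; apply: is_deriveB.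
suff : sinX_prim n 0 - sinX_prim n.+1 0 <= sinX_prim n (pi / 2) - sinX_prim n.+1 (pi / 2).
  by lra.
apply: (@ger0_derive1_ndecr R (sinX_prim n - sinX_prim n.+1) 0 (pi / 2)) => //.
- move=> x; rewrite in_itv /= => /andP[x0 xpi].
  rewrite derive1E derive_val exprS -[X in X - _]mul1r -mulrBl.
  rewrite mulr_ge0 ?subr_ge0 ?sin_le1 // exprn_ge0 // sin_ge0_pi // ltW //=.
  by have := pi_ge0 R; lra.
- apply: continuous_subspaceT => x; exact/differentiable_continuous/derivable1_diffP.
Qed.

(** These are the Wallis integrals of even and odd powers of the sine over [0, pi/2]. *)
Lemma sinX_prim_wallis (n : nat) :
  sinX_prim (2 * n) (pi / 2) - sinX_prim (2 * n) 0 = pi / 2 * ncb R n /\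
  sinX_prim (2 * n).+1 (pi / 2) - sinX_prim (2 * n).+1 0 = ((2 * n%:R + 1) * ncb R n)^-1.
Proof.
elim: n => [|n [IH1 IH2]].
  by rewrite muln0 /= cos_pihalf cos0 [ncb R 0]/ncb; split; field.
have n0 : (0 : R) <= n%:R by [].
have b0 := ncb_gt0 R n.
have -> : ncb R n.+1 = (2 * n%:R + 1) * ncb R n / (2 * n%:R + 2).
  by have := ncb_rec R n => <-; field; apply/lt0r_neq0; lra.
rewrite mulnS !add2n /= cos_pihalf sin0 !expr0n /= !mulr0 !mul0r !subr0.
have E : (2 * n)%:R = 2 * n%:R :> R by rewrite natrM.
have -> : (2 * n).+1%:R = 2 * n%:R + 1 :> R by rewrite -natr1 E.
have -> : (2 * n).+2%:R = 2 * n%:R + 2 :> R by rewrite -!natr1 E; ring.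
have -> : (2 * n).+3%:R = 2 * n%:R + 3 :> R by rewrite -!natr1 E; ring.
rewrite -!mulrBl -!mulrBr IH1 IH2 -[n.+1%:R]natr1; split; field; rewrite ?lt0r_neq0 //; lra.
Qed.

(** Compares the Wallis integrals of exponents [2 * n] and [2 * n + 1]. *)
Lemma ncb_ge (n : nat) : (pi * (n%:R + 2^-1))^-1 <= ncb R n ^+ 2.
Proof.
have n0 : (0 : R) <= n%:R by [].
have [b0 p0] := (ncb_gt0 R n, pi_gt0 R).
have c0 : 0 < (2 * n%:R + 1) * ncb R n by rewrite mulr_gt0 //; lra.
have := sinX_prim_le (2 * n); have [-> ->] := sinX_prim_wallis n.
rewrite -[_^-1]div1r ler_pdivrMr // => h.
rewrite -[_^-1]div1r ler_pdivrMr; last by rewrite mulr_gt0 //; lra.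
by lra.
Qed.

(** Compares the exponents [2 * n + 1] and [2 * n + 2]. The index is a successor because at 0 the
    right-hand side would be the inverse of 0, that is 0. *)
Lemma ncb_le (n : nat) : ncb R n.+1 ^+ 2 <= (pi * n.+1%:R)^-1.
Proof.
have [b0 p0] := (ncb_gt0 R n.+1, pi_gt0 R).
have c0 : 0 < (2 * n%:R + 2) * ncb R n.+1.
  by rewrite mulr_gt0 //; have : (0 : R) <= n%:R by []; lra.
have [E1 _] := sinX_prim_wallis n.+1; have [_ E2] := sinX_prim_wallis n.
have := sinX_prim_le (2 * n).+1.
rewrite -[(2 * n).+2](_ : 2 * n.+1 = _)%N; last by rewrite mulnS add2n.
rewrite E1 E2 -ncb_rec -[(_ * _)^-1]div1r ler_pdivlMr // => h.
by rewrite -[(_ * _)^-1]div1r ler_pdivlMr ?mulr_gt0 // -[n.+1%:R]natr1; lra.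
Qed.
End Wallis.

(** * Enumeration of trees *)

Definition graft (t u : tree) : tree := let: Node a ts := u in Node a (t :: ts).

Definition proper_subtrees (t : tree) : seq tree :=
  let: Node _ ts := t in flatten (map subtrees ts).

Lemma subtreesE (t : tree) : subtrees t = t :: proper_subtrees t.
Proof. by case: t. Qed.

Lemma proper_subtrees_graft (t u : tree) :
  proper_subtrees (graft t u) = t :: proper_subtrees t ++ proper_subtrees u.
Proof. by case: u => a ts /=; rewrite subtreesE. Qed.

Lemma nnodes_graft (t u : tree) : nnodes (graft t u) = (nnodes t + nnodes u)%N.
Proof. by case: u => a ts /=; rewrite addnS. Qed.

Lemma nnodes_gt0 (t : tree) : (0 < nnodes t)%N.
Proof. by case: t. Qed.

Lemma nnodesE (t : tree) : nnodes t = (tsize t).+1.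
Proof. by rewrite /tsize prednK // nnodes_gt0. Qed.

Lemma tsize_graft (t u : tree) : tsize (graft t u) = (tsize t + tsize u).+1.
Proof. by rewrite {1}/tsize nnodes_graft !nnodesE addSn addnS. Qed.

Lemma labeled_in_graft (m : nat) (t u : tree) :
  labeled_in m (graft t u) = labeled_in m t && labeled_in m u.
Proof. by case: u => a ts /=; rewrite andbCA. Qed.

Lemma graft_inj (t u t' u' : tree) : graft t u = graft t' u' -> t = t' /\ u = u'.
Proof. by case: u u' => a ts [a' ts'] [-> -> ->]. Qed.

(** Induction along the detachment of the first child: trees are handled as binary trees, without a
    nested induction on lists of children. *)
Lemma graft_ind (P : tree -> Prop) :
  (forall a, P (Node a [::])) -> (forall t u, P t -> P u -> P (graft t u)) -> forall t, P t.
Proof.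
move=> P0 PS t; have [n] := ubnP (nnodes t).
elim: n t => // n IH [a [//|t ts]] lt; apply: (PS t (Node a ts)).
- by apply: IH; move: lt; rewrite /= ; lia.
- by apply: IH; move: lt (nnodes_gt0 t); rewrite /= ; lia.
Qed.

Lemma tsize_proper_subtrees (s t : tree) :
  s \in proper_subtrees t -> (tsize s < tsize t)%N.
Proof.
elim/graft_ind: t => // t u IHt IHu; rewrite proper_subtrees_graft inE mem_cat tsize_graft.
by move=> /predU1P[->|/orP[/IHt|/IHu]]; lia.
Qed.

Lemma labeled_in_proper_subtrees (m : nat) (s t : tree) :
  labeled_in m t -> s \in proper_subtrees t -> labeled_in m s.
Proof.
elim/graft_ind: t => // t u IHt IHu; rewrite proper_subtrees_graft inE mem_cat.
rewrite labeled_in_graft => /andP[lt lu].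
by move=> /predU1P[->//|/orP[/(IHt lt)|/(IHu lu)]].
Qed.

(* The fuel [f] only has to exceed the size [n]. *)
Fixpoint trees_rec (m f n : nat) : seq tree :=
  if f is f'.+1 then
    if n is n'.+1 then
      [seq t | i <- iota 0 n,
               t <- [seq graft u v | u <- trees_rec m f' i, v <- trees_rec m f' (n' - i)]]
    else [seq Node a [::] | a <- iota 1 m]
  else [::].

Definition trees (m n : nat) : seq tree := trees_rec m n.+1 n.

Lemma mem_trees_rec (m f n : nat) (t : tree) : (n < f)%N ->
  (t \in trees_rec m f n) = labeled_in m t && (tsize t == n).
Proof.
elim: f n t => // f IH [|n] t nf.
  apply/mapP/andP => [[a]|[]].
    by rewrite mem_iota add1n ltnS => am -> /=; rewrite am.
  case: t => a [|t ts] /=; last by rewrite /tsize /= nnodesE.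
  by rewrite andbT => am _; exists a; rewrite // mem_iota add1n ltnS.
apply/allpairsPdep/andP.
  move=> [i [_ [+ /allpairsP[[u v] /= [+ + ->]] ->]]]; rewrite mem_iota => /andP[_ lei].
  rewrite !IH; [|lia..] => /andP[lu /eqP su] /andP[lv /eqP sv].
  by rewrite labeled_in_graft lu lv tsize_graft su sv; split=> //; apply/eqP; lia.
elim/graft_ind: t => [a|t u _ _]; first by rewrite /tsize => -[].
rewrite labeled_in_graft tsize_graft => -[/andP[lt lu] /eqP[stu]].
exists (tsize t), (graft t u); split=> //; first by rewrite mem_iota; lia.
apply/allpairsP; exists (t, u); split=> //=; rewrite IH ?lt ?lu ?eqxx //=; [lia| |lia].
by apply/eqP; lia.
Qed.

Lemma mem_trees (m n : nat) (t : tree) :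
  (t \in trees m n) = labeled_in m t && (tsize t == n).
Proof. exact: mem_trees_rec. Qed.

Lemma uniq_trees_rec (m f n : nat) : (n < f)%N -> uniq (trees_rec m f n).
Proof.
elim: f n => // f IH [|n] nf.
  by rewrite map_inj_uniq ?iota_uniq // => a b [].
apply: allpairs_uniq_dep; first exact: iota_uniq.
  move=> i; rewrite mem_iota => /andP[_ lei].
  apply: allpairs_uniq; rewrite ?IH //; [lia..|].
  by move=> [t u] [t' u'] _ _ /graft_inj[-> ->].
(* The index of the outer enumeration can be read off a tree: it is the size of the first child. *)
move=> _ _ /allpairsPdep[i [t [ii ti ->]]] /allpairsPdep[j [u [jj uj ->]]] /= tu.
move: ti uj; rewrite tu => /allpairsP[[t1 t2] /= [t1i _ ->]].
move=> /allpairsP[[u1 u2] /= [u1j _ /graft_inj[E _]]].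
move: ii jj; rewrite !mem_iota => /andP[_ lei] /andP[_ lej].
move: t1i u1j; rewrite -E !mem_trees_rec; [|lia..].
by move=> /andP[_ /eqP->] /andP[_ /eqP->].
Qed.

Lemma uniq_trees (m n : nat) : uniq (trees m n).
Proof. exact: uniq_trees_rec. Qed.

Lemma big_trees0 (R : nmodType) (m : nat) (F : tree -> R) :
  \sum_(t <- trees m 0) F t = \sum_(1 <= a < m.+1) F (Node a [::]).
Proof. by rewrite big_map /index_iota subn1. Qed.

(** All recurrences below come from this decomposition. Different amounts of sufficient fuel give
    enumerations that agree up to permutation. *)
Lemma big_treesS (R : nmodType) (m n : nat) (F : tree -> R) :
  \sum_(t <- trees m n.+1) F t =
  \sum_(i < n.+1) \sum_(t <- trees m i) \sum_(u <- trees m (n - i)) F (graft t u).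
Proof.
rewrite big_allpairs_dep -[iota 0 n.+1]/(index_iota 0 n.+1) big_mkord.
apply: eq_bigr => -[i /= lei] _.
rewrite big_allpairs_dep.
have perm k : (k <= n)%N -> perm_eq (trees_rec m n.+1 k) (trees m k).
  move=> ?; apply: uniq_perm; rewrite ?uniq_trees ?uniq_trees_rec // => t.
  by rewrite mem_trees mem_trees_rec.
rewrite (perm_big _ (perm _ lei)); apply: eq_bigr => t _.
by apply: perm_big; apply: perm; lia.
Qed.

(** * Counting occurrences of a fixed subtree *)

Lemma sum_shift (R : nmodType) (F : nat -> R) (k n : nat) :
  (forall i, (i < k)%N -> F i = 0) ->
  \sum_(i < (k + n).+1) F i = \sum_(i < n.+1) F (k + i)%N.
Proof.
by move=> F0; rewrite -addnS big_split_ord /= big1 ?add0r // => i _; exact: F0.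
Qed.

Lemma sum_delta (R : pzRingType) (F : nat -> R) (k n : nat) :
  \sum_(i < n.+1) (i == k :> nat)%:R * F i = (k <= n)%:R * F k.
Proof.
have [kn|nk] := leqP k n.
  rewrite (bigD1 (Ordinal (kn : (k < n.+1)%N))) //= eqxx big1 ?addr0 // => i.
  by rewrite -val_eqE /= => /negPf->; rewrite mul0r.
rewrite mul0r big1 // => i _; rewrite [i == k :> nat](_ : _ = false) ?mul0r //.
by have := ltn_ord i; lia.
Qed.

Lemma expr_ord_split (R : pzRingType) (x : R) (n : nat) (i : 'I_n.+1) :
  x ^+ n = x ^+ i * x ^+ (n - i).
Proof. by rewrite -exprD subnKC // leq_ord. Qed.

Section TreeCounting.
Context (R : realFieldType) (m : nat).
Local Notation q := (4 * m%:R : R).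
Local Notation ncb := (ncb R).
Local Notation nct := (nct R).

Definition ntrees (n : nat) : R := \sum_(t <- trees m n) 1.

Lemma sum_trees_cst (n : nat) (x : R) : \sum_(t <- trees m n) x = x * ntrees n.
Proof. by rewrite mulr_sumr; apply: eq_bigr => t _; rewrite mulr1. Qed.

Lemma ntreesE (n : nat) : ntrees n = m%:R * q ^+ n * nct n.
Proof.
have [k] := ubnP n; elim: k n => // k IH [|n] nk.
  by rewrite /ntrees big_trees0 sumr_const_nat subn1 nct0 !mulr1.
rewrite /ntrees big_treesS.
transitivity (\sum_(i < n.+1) m%:R ^+ 2 * q ^+ n * (nct i * nct (n - i))).
  apply: eq_bigr => i _; under eq_bigr do rewrite sum_trees_cst mul1r.
  have lei := leq_ord i.
  rewrite sum_trees_cst !IH; [|lia..].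
  by rewrite (expr_ord_split _ _ _ i); ring.
by rewrite -mulr_sumr nct_conv [in RHS]exprS; ring.
Qed.

Lemma ntrees_ge0 (n : nat) : 0 <= ntrees n.
Proof. exact: sumr_ge0. Qed.

Lemma sum_eq_trees (s : tree) (n : nat) (f : tree -> R) : labeled_in m s ->
  \sum_(t <- trees m n) (t == s)%:R * f t = (n == tsize s)%:R * f s.
Proof.
move=> ls; have [e|ne] := eqVneq.
  rewrite (bigD1_seq s) ?uniq_trees ?mem_trees ?ls ?e ?eqxx //= big1 ?addr0 // => t.
  by move=> /negPf->; rewrite mul0r.
rewrite mul0r big1_seq // => t /andP[_]; rewrite mem_trees => /andP[_ /eqP st].
have [ts|] := eqVneq t s; last by rewrite mul0r.
by move: ne; rewrite -ts st eqxx.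
Qed.

(** Only proper occurrences are counted: grafting keeps those of both trees and adds [t] itself,
    whereas [u] as a whole is no longer a subtree at the root. *)
Definition occ (s t : tree) : R := (count_mem s (proper_subtrees t))%:R.

Lemma occ_graft (s t u : tree) : occ s (graft t u) = (t == s)%:R + occ s t + occ s u.
Proof. by rewrite /occ proper_subtrees_graft /= count_cat !natrD addrA. Qed.

Lemma occ_eq0 (s t : tree) : (tsize t <= tsize s)%N -> occ s t = 0.
Proof.
move=> le; rewrite /occ (count_memPn _) //.
by apply/negP => /tsize_proper_subtrees; lia.
Qed.

Definition sum_occ (s : tree) (n : nat) : R := \sum_(t <- trees m n) occ s t.

Definition sum_occ_pairs (s : tree) (n : nat) : R :=
  \sum_(t <- trees m n) occ s t * (occ s t - 1).

Section FixedSubtree.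
Context (s : tree) (ls : labeled_in m s).
Local Notation k := (tsize s).
Local Notation P := (sum_occ s).
Local Notation Q := (sum_occ_pairs s).

Lemma sum_occ0 (n : nat) : (n <= k)%N -> P n = 0.
Proof.
move=> nk; rewrite /sum_occ big1_seq // => t /andP[_].
by rewrite mem_trees => /andP[_ /eqP st]; rewrite occ_eq0 ?st.
Qed.

Lemma sum_occS (n : nat) :
  P n.+1 = (k <= n)%:R * ntrees (n - k) + 2 * \sum_(i < n.+1) P i * ntrees (n - i).
Proof.
rewrite /sum_occ big_treesS.
transitivity (\sum_(i < n.+1) ((i == k :> nat)%:R * ntrees (n - i)
     + P i * ntrees (n - i) + ntrees i * P (n - i))).
  apply: eq_bigr => i _; under eq_bigr => t _.
    under eq_bigr => u _ do rewrite occ_graft.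
    rewrite big_split /= sum_trees_cst mulrDl; over.
  rewrite !big_split /= sum_trees_cst; congr (_ + _ + _).
  - exact: (sum_eq_trees _ _ (fun=> ntrees (n - i)) ls).
  - by rewrite -mulr_suml.
  - exact: mulrC.
rewrite !big_split /= (sum_delta _ (fun i => ntrees (n - i))) (conv_rev _ ntrees).
rewrite [2 * _]mulrDl !mul1r addrA.
by congr (_ + _ + _); apply: eq_bigr => i _; rewrite mulrC.
Qed.

(* The correction at [n = 0] is there because [s] is not a proper subtree of itself. *)
Lemma sum_occE (n : nat) : P (k + n) = q ^+ n * (ncb n - (n == 0)%N%:R) / 2.
Proof.
have [l] := ubnP n; elim: l n => // l IH [|n] nl.
  by rewrite addn0 sum_occ0 // subrr mulr0 mul0r.
rewrite addnS sum_occS leq_addr mul1r addKn (@sum_shift _ (fun i => P i * ntrees (k + n - i))).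
  have -> : \sum_(i < n.+1) P (k + i) * ntrees (k + n - (k + i)) =
     m%:R * q ^+ n / 2 * \sum_(i < n.+1) (ncb i * nct (n - i) - (i == 0%N :> nat)%:R * nct (n - i)).
    rewrite mulr_sumr; apply: eq_bigr => i _; have lei := leq_ord i.
    rewrite IH; last by lia.
    by rewrite subnDl ntreesE (expr_ord_split _ _ _ i); ring.
  (* The correction at [i = 0] contributes exactly minus the term [ntrees n] that stands for [s] as
     first child, so only [ncb n.+1] remains. *)
  rewrite sumrB nct_ncb_conv (sum_delta _ (fun i => nct (n - i))) subn0 ntreesE exprS mul1r.
  by rewrite /= subr0; field.
by move=> i ik; rewrite sum_occ0 ?mul0r ?(ltnW ik).
Qed.

(** If [t] is [s], then [occ s t] is 0, and the only new pairs join the new occurrence to one in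
    [u], in either order. *)
Lemma sum_occ_pairs_graft (t u : tree) :
  occ s (graft t u) * (occ s (graft t u) - 1) =
  occ s t * (occ s t - 1) + occ s u * (occ s u - 1)
    + 2 * (occ s t * occ s u) + 2 * ((t == s)%:R * occ s u).
Proof.
rewrite occ_graft; have [->|_] := eqVneq t s; last by rewrite /=; ring.
by rewrite (occ_eq0 _ _ (leqnn _)) /=; ring.
Qed.

Lemma sum_occ_pairsS (n : nat) :
  Q n.+1 = 2 * \sum_(i < n.+1) Q i * ntrees (n - i)
    + 2 * \sum_(i < n.+1) P i * P (n - i) + 2 * ((k <= n)%:R * P (n - k)).
Proof.
rewrite /sum_occ_pairs big_treesS.
transitivity (\sum_(i < n.+1) (Q i * ntrees (n - i) + ntrees i * Q (n - i)
     + 2 * (P i * P (n - i)) + 2 * ((i == k :> nat)%:R * P (n - i)))).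
  apply: eq_bigr => i _; under eq_bigr => t _.
    under eq_bigr => u _ do rewrite sum_occ_pairs_graft.
    rewrite !big_split /= sum_trees_cst -!mulr_sumr -[\sum_(_ <- _) occ _ _]/(P (n - i)); over.
  rewrite !big_split /= sum_trees_cst -!mulr_sumr; congr (_ + _ + _ * _ + _ * _).
  - by rewrite -mulr_suml.
  - exact: mulrC.
  - by rewrite -mulr_suml.
  - exact: (sum_eq_trees _ _ (fun=> P (n - i)) ls).
rewrite !big_split /= -!mulr_sumr (sum_delta _ (fun i => P (n - i))) (conv_rev _ ntrees).
rewrite [2 * \sum_(i < _) Q _ * _]mulrDl !mul1r.
by congr (_ + _ + _ + _); apply: eq_bigr => i _; rewrite mulrC.
Qed.

(** Two different occurrences of one tree are disjoint, so together they force more than [2 * k]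
    edges. The proof reads this off the recurrence. *)
Lemma sum_occ_pairs0 (n : nat) : (n <= 2 * k)%N -> Q n = 0.
Proof.
have [l] := ubnP n; elim: l n => // l IH [|n] nl nk.
  rewrite /sum_occ_pairs big1_seq // => t /andP[_].
  by rewrite mem_trees => /andP[_ /eqP st]; rewrite occ_eq0 ?st // mul0r.
rewrite sum_occ_pairsS big1 => [|i _]; last first.
  by have := leq_ord i => lei; rewrite IH ?mul0r //; lia.
rewrite big1 => [|i _]; last first.
  have [ik|ki] := leqP i k; first by rewrite sum_occ0 // mul0r.
  by rewrite [P (n - i)]sum_occ0 ?mulr0 //; lia.
by rewrite sum_occ0 ?mulr0 ?addr0 //; lia.
Qed.

(** Both factors vanish below [k], which cuts [k] terms off each end. The two corrections at 0 then
    turn the value 1 of [ncb_conv] into the last factor. *)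
Lemma sum_occ_conv (n : nat) : \sum_(i < (2 * k + n).+1) P i * P (2 * k + n - i) =
  q ^+ n / 4 * (1 - 2 * ncb n + (n == 0)%N%:R).
Proof.
have P0 i : (i < k)%N -> P i = 0 by move=> /ltnW /sum_occ0.
rewrite mul2n -addnn -addnA (@sum_shift _ (fun i => P i * P (k + (k + n) - i))); last first.
  by move=> i /P0->; rewrite mul0r.
under eq_bigr => i _ do rewrite subnDl.
rewrite (conv_rev _ (fun i => P (k + i)%N)).
rewrite (@sum_shift _ (fun i => P (k + (k + n - i)) * P i)); last first.
  by move=> i /P0->; rewrite mulr0.
transitivity (\sum_(i < n.+1) q ^+ n / 4 * (ncb i * ncb (n - i)
    - (i == 0%N :> nat)%:R * (ncb (n - i) - (n - i == 0)%N%:R) - ncb i * (n - i == 0)%N%:R)).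
  by apply: eq_bigr => i _; rewrite subnDl !sum_occE (expr_ord_split _ _ _ i); field.
rewrite -mulr_sumr !sumrB ncb_conv (sum_delta _ (fun i => ncb (n - i) - (n - i == 0)%N%:R)) subn0.
rewrite (conv_rev _ _ (fun i => (i == 0%N :> nat)%:R)).
under eq_bigr => i _ do rewrite mulrC.
by rewrite (sum_delta _ (fun i => ncb (n - i))) subn0 !mul1r; ring.
Qed.

(* The right-hand side solves the recurrence [sum_occ_pairsS] with its last two terms
   replaced by their upper bound [q ^+ n / 2]. *)
Lemma sum_occ_pairs_le (n : nat) : q * Q (2 * k + n) <= q ^+ n * (n%:R * ncb n).
Proof.
have q0 : 0 <= q by rewrite mulr_ge0.
have [l] := ubnP n; elim: l n => // l IH [|n] nl.
  by rewrite addn0 sum_occ_pairs0 // mulr0 mul0r mulr0.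
rewrite addnS sum_occ_pairsS sum_occ_conv.
rewrite [(k <= _)%N](_ : _ = true) ?mul1r; last by lia.
rewrite [(2 * k + n - k)%N](_ : _ = k + n)%N ?sum_occE; last by lia.
rewrite (@sum_shift _ (fun i => Q i * ntrees (2 * k + n - i))); last first.
  by move=> i ik; rewrite sum_occ_pairs0 ?mul0r ?(ltnW ik).
have main : q * \sum_(i < n.+1) Q (2 * k + i) * ntrees (2 * k + n - (2 * k + i)) <=
    m%:R * q ^+ n * (2 * n.+1%:R * ncb n.+1 - 1).
  rewrite -mul_ncb_nct_conv !mulr_sumr; apply: ler_sum => i _; have lei := leq_ord i.
  rewrite subnDl mulrA.
  apply: (le_trans (ler_wpM2r (ntrees_ge0 _) (IH i _))); first by lia.
  by rewrite ntreesE (expr_ord_split _ _ _ i) le_eqVlt; apply/orP; left; apply/eqP; ring.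
have d0 : 0 <= q ^+ n.+1 * (n == 0)%N%:R by rewrite mulr_ge0 ?exprn_ge0.
by move: main d0; rewrite exprS; lra.
Qed.

End FixedSubtree.
End TreeCounting.

(** * Moment bounds for the number of distinct subtrees *)

Lemma dag_nodesE (t : tree) : dag_nodes t = (size (undup (proper_subtrees t))).+1.
Proof.
rewrite /dag_nodes subtreesE /=; case: ifP => // /tsize_proper_subtrees.
by rewrite ltnn.
Qed.

(** Each proper subtree lies in exactly one of the lists [trees m k] with [k < n], so [U] enumerates
    all candidates without repetition. *)
Lemma size_undup_proper_subtrees (R : pzSemiRingType) (m n : nat) (t : tree) :
  t \in trees m n ->
  (size (undup (proper_subtrees t)))%:R =
  \sum_(0 <= k < n) \sum_(s <- trees m k) (s \in proper_subtrees t)%:R :> R.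
Proof.
rewrite mem_trees => /andP[lt /eqP st].
pose U := [seq s | k <- iota 0 n, s <- trees m k].
have UU : uniq U.
  apply: allpairs_uniq_dep; [exact: iota_uniq|by move=> k _; exact: uniq_trees|].
  move=> _ _ /allpairsPdep[i [u [_ ui ->]]] /allpairsPdep[j [v [_ vj ->]]] /= uv.
  by move: ui vj; rewrite uv !mem_trees => /andP[_ /eqP->] /andP[_ /eqP->].
have pU : perm_eq (undup (proper_subtrees t)) [seq s <- U | s \in proper_subtrees t].
  apply: uniq_perm; rewrite ?undup_uniq ?filter_uniq // => s.
  rewrite mem_undup mem_filter /=; have [sp|//] := boolP (s \in proper_subtrees t).
  apply/esym/allpairsPdep; exists (tsize s), s.
  rewrite mem_iota mem_trees eqxx (labeled_in_proper_subtrees _ _ _ lt sp); split=> //.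
  by have := tsize_proper_subtrees _ _ sp; lia.
rewrite (perm_size pU) size_filter -sum1_count natr_sum big_mkcond big_allpairs_dep.
rewrite /index_iota subn0; apply: eq_bigr => k _; apply: eq_bigr => s _.
by case: (s \in _).
Qed.

Section DagBounds.
Context (R : realFieldType) (m : nat) (hm : (0 < m)%N).
Local Notation q := (4 * m%:R : R).
Local Notation ncb := (ncb R).
Local Notation nct := (nct R).
Local Notation ntrees := (ntrees R m).

Definition tree_hits (k n : nat) : R :=
  \sum_(s <- trees m k) \sum_(t <- trees m n) (s \in proper_subtrees t)%:R.

Definition sum_dag (n : nat) : R := \sum_(t <- trees m n) (dag_nodes t)%:R.

Lemma sum_dagE (n : nat) : sum_dag n = ntrees n + \sum_(0 <= k < n) tree_hits k n.
Proof.
rewrite /sum_dag big_seq.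
under eq_bigr => t tn.
  rewrite dag_nodesE -natr1 addrC (size_undup_proper_subtrees _ _ _ _ tn); over.
rewrite -big_seq big_split /= exchange_big; congr (_ + _).
by apply: eq_bigr => k _; exact: exchange_big.
Qed.

Lemma tree_hits_ge0 (k n : nat) : 0 <= tree_hits k n.
Proof. by apply: sumr_ge0 => s _; exact: sumr_ge0. Qed.

Lemma tree_hits_le_ntrees (k n : nat) : tree_hits k n <= ntrees k * ntrees n.
Proof.
rewrite mulr_suml; apply: ler_sum => s _; rewrite mul1r.
by apply: ler_sum => t _; case: (_ \in _).
Qed.

Lemma mem_le_occ (s t : tree) : (s \in proper_subtrees t)%:R <= occ R s t.
Proof. by rewrite /occ ler_nat -has_pred1 has_count; case: count. Qed.

(** Bonferroni's inequality: X - X(X-1)/2 is at most 1 for every natural number X, and is 0 for X =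
    0. *)
Lemma occ_le_mem (s t : tree) :
  occ R s t - occ R s t * (occ R s t - 1) / 2 <= (s \in proper_subtrees t)%:R.
Proof.
rewrite /occ -has_pred1 has_count; case: (count _ _) => [|[|c]] /=; [lra|lra|].
have c0 : (0 : R) <= c%:R by [].
by rewrite -[c.+2%:R]natr1 -[c.+1%:R]natr1; nra.
Qed.

Lemma sum_trees_sum_occ (k n : nat) : (k < n)%N ->
  \sum_(s <- trees m k) sum_occ R m s n = m%:R * q ^+ n * (nct k * ncb (n - k) / 2).
Proof.
move=> kn; transitivity (\sum_(s <- trees m k) q ^+ (n - k) * ncb (n - k) / 2).
  apply: eq_big_seq => s; rewrite mem_trees => /andP[ls /eqP ss].
  rewrite -{1}(subnKC (ltnW kn)) -{1}ss sum_occE //.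
  (* Since [k < n], the correction in [sum_occE] vanishes. *)
  by rewrite [(_ == 0)%N](_ : _ = false) ?subr0 //; lia.
have -> : q ^+ n = q ^+ k * q ^+ (n - k) by rewrite -exprD subnKC // ltnW.
by rewrite sum_trees_cst ntreesE; ring.
Qed.

Lemma tree_hits_le (k n : nat) : (k < n)%N ->
  tree_hits k n <= m%:R * q ^+ n * (nct k * ncb (n - k) / 2).
Proof.
move=> kn; rewrite -sum_trees_sum_occ //; apply: ler_sum => s _.
by apply: ler_sum => t _; exact: mem_le_occ.
Qed.

Let q_gt0 : 0 < q. Proof. by rewrite mulr_gt0 // ltr0n. Qed.

(** First moment minus half the pair bound. Monotonicity of [ncb n] and of [n%:R * ncb n] replaces
    the arguments [n - k] and [n - 2 * k] by [n]. In the pair term, of order [q ^+ k] choices of [s]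
    meet a loss of [q ^+ (2 * k + 1)], which leaves the power [k.+1] of [q^-1]. *)
Lemma tree_hits_ge (k n : nat) : (2 * k <= n)%N -> (0 < n)%N ->
  m%:R * q ^+ n * ncb n * (nct k / 2 - nct k * n%:R / 2 * q^-1 ^+ k.+1) <= tree_hits k n.
Proof.
move=> kn n0; have kn' : (k < n)%N by lia.
have mq0 : 0 <= m%:R * q ^+ n by rewrite mulr_ge0 // exprn_ge0 // ltW.
have lo : \sum_(s <- trees m k) (sum_occ R m s n - sum_occ_pairs R m s n / 2) <= tree_hits k n.
  apply: ler_sum => s _; rewrite mulr_suml -sumrB.
  by apply: ler_sum => t _; exact: occ_le_mem.
apply: le_trans lo; rewrite sumrB sum_trees_sum_occ // -mulr_suml.
have first : m%:R * q ^+ n * (nct k / 2 * ncb n) <= m%:R * q ^+ n * (nct k * ncb (n - k) / 2).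
  rewrite ler_wpM2l // mulrAC ler_pM2r // ler_pM2l ?nct_gt0 //.
  by apply: ncb_nonincreasing; exact: leq_subr.
have second : \sum_(s <- trees m k) sum_occ_pairs R m s n <=
    m%:R * q ^+ n * ncb n * nct k * n%:R * q^-1 ^+ k.+1.
  have bnd s : s \in trees m k ->
      sum_occ_pairs R m s n <= q^-1 * (q ^+ (n - 2 * k) * (n%:R * ncb n)).
    rewrite mem_trees => /andP[ls /eqP ss].
    rewrite ler_pdivlMl //; have := sum_occ_pairs_le R m s ls (n - 2 * k).
    rewrite ss subnKC // => /le_trans; apply; rewrite ler_wpM2l ?exprn_ge0 ?(ltW q_gt0) //.
    by apply: mul_ncb_nondecreasing; exact: leq_subr.
  rewrite big_seq; apply: le_trans (ler_sum _ bnd) _; rewrite -big_seq sum_trees_cst ntreesE.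
  rewrite [leRHS](_ : _ = m%:R * nct k * n%:R * ncb n * (q ^+ n * q^-1 ^+ k.+1)); last by ring.
  have -> : q ^+ n = q ^+ k * q ^+ k * q ^+ (n - 2 * k).
    by rewrite -!exprD; congr (_ ^+ _); lia.
  rewrite exprS exprVn.
  rewrite le_eqVlt; apply/orP; left; apply/eqP; field.
  by rewrite (expf_neq0 _ (lt0r_neq0 q_gt0)) pnatr_eq0 -lt0n.
by move: first second; lra.
Qed.

(** From size 1 on the counts at least double at each step. From size 0 to size 1 they may stay
    equal, hence the separate case. *)
Lemma sum_ntrees_le (n : nat) : \sum_(0 <= k < n) ntrees k <= ntrees n.
Proof.
have m1 : 1 <= m%:R :> R by rewrite ler1n.
elim: n => [|n IH]; first by rewrite big_geq // ntrees_ge0.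
rewrite big_nat_recr //=; case: n IH => [|n] IH.
  by rewrite big_geq // add0r !ntreesE expr0 expr1; have := nct_rec R 0; rewrite nct0; nra.
apply: le_trans (lerD IH (lexx _)) _; rewrite !ntreesE [q ^+ n.+2]exprS.
have n0 : 0 <= n%:R :> R by [].
have c0 := nct_gt0 R n.+1.
have step : nct n.+1 <= 2 * nct n.+2.
  have := nct_rec R n.+1; rewrite -[n.+1%:R]natr1 => E.
  rewrite -(@ler_pM2l _ (2 * (n%:R + 1) + 1)); last by lra.
  by rewrite -E; have := nct_gt0 R n.+2; nra.
have w0 : 0 <= m%:R * q ^+ n.+1 by rewrite mulr_ge0 // exprn_ge0 // ltW.
have h : m%:R * q ^+ n.+1 * nct n.+1 <= m%:R * q ^+ n.+1 * (2 * nct n.+2) by rewrite ler_wpM2l.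
have h2 : 1 * (m%:R * q ^+ n.+1 * nct n.+2) <= m%:R * (m%:R * q ^+ n.+1 * nct n.+2).
  by rewrite ler_wpM2r // mulr_ge0 // ltW // nct_gt0.
by lra.
Qed.

Lemma sum_nct (a b : nat) : (a <= b)%N -> \sum_(a <= k < b) nct k / 2 = ncb a - ncb b.
Proof.
move=> ab; rewrite -opprB -telescope_sumr // -sumrN; apply: eq_bigr => k _.
by rewrite nctE; field.
Qed.

(* Subtract from the full convolution [nct_ncb_conv] the terms k < a, in which
   [ncb (n - k) >= ncb n]. *)
Lemma sum_nct_ncb_le (a n : nat) : (a <= n)%N ->
  \sum_(a <= k < n) nct k * ncb (n - k) / 2 <= ncb n * ncb a.
Proof.
move=> an; have tot := nct_ncb_conv R n.
rewrite conv_rev -(big_mkord predT (fun k => ncb (n - k) * nct k)) in tot.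
rewrite big_nat_recr //= subnn (@big_cat_nat _ _ _ a) //= in tot.
have head : ncb n * (1 - ncb a) <= \sum_(0 <= k < a) ncb (n - k) * nct k / 2.
  rewrite -(sum_nct 0) // mulr_sumr; apply: ler_sum => k _.
  rewrite -mulrA ler_wpM2r ?divr_ge0 ?(ltW (ncb_gt0 _ _)) //.
  by apply: ncb_nonincreasing; exact: leq_subr.
have E : \sum_(a <= k < n) nct k * ncb (n - k) / 2 = (\sum_(a <= k < n) ncb (n - k) * nct k) / 2.
  by rewrite mulr_suml; apply: eq_bigr => k _; rewrite [nct k * _]mulrC.
rewrite -mulr_suml in head; rewrite E; move: tot head (nct_gt0 R n); rewrite !(nctE R n) ncb0; lra.
Qed.

(** Sizes below [K] get the trivial bound, the others the first moment. The 1 stands for the whole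
    tree, and [n.+1] arises from [mul_nct]. *)
Lemma sum_dag_le (K n : nat) : (K <= n)%N ->
  sum_dag n <= ntrees n * (1 + ntrees K + n.+1%:R * ncb K).
Proof.
move=> Kn; rewrite sum_dagE !mulrDr mulr1 -addrA lerD2l (@big_cat_nat _ _ _ K) //=.
apply: lerD.
  apply: le_trans (ler_sum _ (fun k _ => tree_hits_le_ntrees k n)) _.
  by rewrite -mulr_suml mulrC ler_wpM2l ?ntrees_ge0 ?sum_ntrees_le.
rewrite big_nat; apply: le_trans.
  by apply: ler_sum => k /andP[_ kn]; exact: tree_hits_le kn.
rewrite -big_nat -mulr_sumr ntreesE.
rewrite [leRHS](_ : _ = m%:R * q ^+ n * (ncb n * ncb K)); last by rewrite -(mul_nct R n); ring.
by rewrite ler_wpM2l ?sum_nct_ncb_le // mulr_ge0 // exprn_ge0 // ltW.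
Qed.

(** Only sizes from [K] up to [L] are kept. There the loss from repeated subtrees is a geometric
    sum, and [n%:R <= q ^+ K.+1] brings it below [nct R K]. *)
Lemma sum_dag_ge (K L n : nat) : (K <= L)%N -> (2 * L <= n)%N -> (0 < n)%N ->
  n%:R <= q ^+ K.+1 ->
  ntrees n * (n.+1%:R * (ncb K - ncb L - nct K)) <= sum_dag n.
Proof.
move=> KL Ln n0 nq.
have q4 : 4 <= q by rewrite ler_peMr // ler1n.
have x0 : 0 < q^-1 by rewrite invr_gt0.
have x4 : q^-1 <= 4^-1 by rewrite lef_pV2 ?posrE.
(* The ratio is at most 1/4, so the sum is at most 4/3 of its first term; the proof telescopes. *)
have geom : 3 * \sum_(K <= k < L) q^-1 ^+ k.+1 <= 4 * q^-1 ^+ K.+1.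
  rewrite mulr_sumr -[leRHS]subr0.
  apply: (@le_trans _ _ (4 * q^-1 ^+ K.+1 - 4 * q^-1 ^+ L.+1)); last first.
    by rewrite lerD2l lerN2 mulr_ge0 // exprn_ge0 // ltW.
  rewrite -opprB -(telescope_sumr (fun k => 4 * q^-1 ^+ k.+1)) // -sumrN.
  apply: ler_sum => k _; rewrite [q^-1 ^+ k.+2]exprS.
  have y0 : 0 < q^-1 ^+ k.+1 by exact: exprn_gt0.
  nra.
have w0 : 0 <= m%:R * q ^+ n * ncb n.
  by rewrite !mulr_ge0 ?exprn_ge0 ?(ltW q_gt0) ?(ltW (ncb_gt0 _ _)).
rewrite sum_dagE (@big_cat_nat _ _ _ K) //=; last by lia.
rewrite (@big_cat_nat _ _ _ L K n) //=; last by lia.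
set S0 := \sum_(0 <= k < K) _; set S2 := \sum_(L <= k < n) _.
have S00 : 0 <= S0 by apply: sumr_ge0 => *; exact: tree_hits_ge0.
have S20 : 0 <= S2 by apply: sumr_ge0 => *; exact: tree_hits_ge0.
suff : ntrees n * (n.+1%:R * (ncb K - ncb L - nct K)) <= \sum_(K <= k < L) tree_hits k n.
  by have := ntrees_ge0 R m n; lra.
rewrite ntreesE [leLHS](_ : _ = m%:R * q ^+ n * ncb n * (ncb K - ncb L - nct K)); last first.
  by rewrite -(mul_nct R n); ring.
apply: (@le_trans _ _ (\sum_(K <= k < L) m%:R * q ^+ n * ncb n *
    (nct k / 2 - nct K * n%:R / 2 * q^-1 ^+ k.+1))).
  rewrite -mulr_sumr ler_wpM2l // sumrB sum_nct // lerD2l lerN2 -mulr_sumr.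
  have c0 := nct_gt0 R K.
  have nx : n%:R * q^-1 ^+ K.+1 <= 1.
    by rewrite exprVn ler_pdivrMr ?exprn_gt0 // mul1r.
  apply: (@le_trans _ _ (nct K * n%:R / 2 * (4 / 3 * q^-1 ^+ K.+1))); last by nra.
  rewrite ler_wpM2l //; first by rewrite divr_ge0 // mulr_ge0 // ltW.
  by rewrite -(@ler_pM2l _ 3) //; apply: le_trans geom _; lra.
rewrite big_nat [leRHS]big_nat; apply: ler_sum => k /andP[Kk kL].
apply: le_trans (tree_hits_ge k n _ n0); last by lia.
rewrite ler_wpM2l // lerD2l lerN2 ler_wpM2r ?exprn_ge0 ?(ltW x0) //.
by rewrite ler_pM2r // ler_wpM2r // nct_nonincreasing.
Qed.

End DagBounds.

(** * Asymptotics *)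

Lemma avg_dag_nodesE (R : realType) (m n : nat) :
  avg_dag_nodes R m n = sum_dag R m n / ntrees R m n.
Proof.
rewrite /avg_dag_nodes; have -> : mtrees m n = [set` trees m n]%classic.
  apply/seteqP; split => t /=; rewrite mem_trees; first by case=> -> ->; rewrite eqxx.
  by case/andP => ? /eqP.
by rewrite -!fsbig_seq ?uniq_trees.
Qed.

(** The cube is what [ncb_half_le] needs: the square of [ncb R n./2] is of order 1/n and has to be
    of order 1/K^3. *)
Lemma leq_cube_expn4 (k : nat) : (k ^ 3 <= 4 ^ k)%N.
Proof.
(* The induction starts at 2: from 1 to 2 the cube grows by a factor 8, afterwards by less than
   4. *)
suff H j : ((j + 2) ^ 3 <= 4 ^ (j + 2))%N.
  by case: k => [|[|k]] //; have := H k; rewrite !addn2.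
elim: j => // j IH; rewrite addSn [(4 ^ _)%N]expnS.
by apply: leq_trans (leq_mul (leqnn 4) IH); rewrite !expnS expn0; nia.
Qed.

Section Asymptotics.
Context (R : realType) (m : nat) (hm : (0 < m)%N).
Local Notation q := (4 * m%:R : R).

Lemma ncb_ge_half (K : nat) : (0 < K)%N -> 2^-1 <= K%:R * ncb R K.
Proof.
move=> K0; apply: le_trans (mul_ncb_nondecreasing R _ _ K0).
by have := ncb_rec R 0; rewrite ncb0; lra.
Qed.

(** Makes the truncation of the sizes at [n./2] cost only a relative error of order 1/K. *)
Lemma ncb_half_le (K n : nat) : (0 < K)%N -> (4 ^ K <= n)%N ->
  ncb R n./2 <= 3 * ncb R K / K%:R.
Proof.
move=> K0 Kn; have K1 : 1 <= K%:R :> R by rewrite ler1n.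
have L0 : (0 < n./2)%N.
  have : (4 ^ 1 <= 4 ^ K)%N by rewrite leq_exp2l.
  by rewrite expn1; lia.
rewrite ler_pdivlMr ?ltr0n // -(@ler_pXn2r _ 2) ?nnegrE ?mulr_ge0 ?(ltW (ncb_gt0 _ _)) //.
have [Wl p0] := (ncb_ge R K, pi_gt0 R).
have Wu : ncb R n./2 ^+ 2 <= (pi * (n./2)%:R)^-1 by rewrite -(prednK L0); exact: ncb_le.
have KL : K%:R ^+ 3 <= 4 * (n./2)%:R :> R.
  rewrite -natrX -natrM ler_nat; apply: leq_trans (leq_cube_expn4 K) _.
  by move: Kn L0; lia.
rewrite !exprMn.
have K0' : 0 < K%:R ^+ 2 :> R by rewrite exprn_gt0 // ltr0n.
have LR : 0 < (n./2)%:R :> R by rewrite ltr0n.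
apply: (@le_trans _ _ ((pi * (n./2)%:R)^-1 * K%:R ^+ 2)); first by rewrite ler_pM2r.
apply: (@le_trans _ _ (3 ^+ 2 * (pi * (K%:R + 2^-1))^-1)); last by rewrite ler_pM2l.
rewrite mulrC ler_pdivrMr ?mulr_gt0 // mulrAC ler_pdivlMr; last by rewrite mulr_gt0 //; lra.
rewrite ![_ * (pi * _)]mulrCA ler_pM2l //.
by move: KL; rewrite exprS; nra.
Qed.

(** In the constant, [m] comes from the trees of size below [K] in the upper bound. The 8 comes from
    the lower bound: the errors 3 of [ncb_half_le] and 1 of [cK], doubled by [n + 1 <= 2 * n]. *)
Lemma avg_dag_near (K n : nat) : (0 < K)%N -> ((4 * m) ^ K <= n <= (4 * m) ^ K.+1)%N ->
  `|avg_dag_nodes R m n / (n%:R * ncb R K) - 1| <= (m%:R + 8) / K%:R.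
Proof.
move=> K0 /andP[Kn nK].
have K1 : 1 <= K%:R :> R by rewrite ler1n.
have Kn4 : (4 ^ K <= n)%N by apply: leq_trans Kn; rewrite leq_exp2r //; lia.
have K3n : (K ^ 3 <= n)%N := leq_trans (leq_cube_expn4 K) Kn4.
have n4 : (4 <= n)%N by apply: leq_trans Kn4; rewrite -[X in (X <= _)%N]expn1 leq_exp2l.
have qK : q ^+ K <= n%:R by rewrite -natrM -natrX ler_nat.
have nq : n%:R <= q ^+ K.+1 by rewrite -natrM -natrX ler_nat.
have n1 : 4 <= n%:R :> R by rewrite ler_nat.
have b0 := ncb_gt0 R K.
have nb0 : 0 < n%:R * ncb R K by rewrite mulr_gt0 //; lra.
have t0 : 0 < ntrees R m n.
  by rewrite ntreesE !mulr_gt0 ?nct_gt0 ?exprn_gt0 ?mulr_gt0 ?ltr0n ?ncb_gt0.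
have KL : (K <= n./2)%N.
  have [|K2] := leqP K 1; first by lia.
  have : (K * 2 <= K ^ 3)%N by rewrite expnS leq_mul2l expnS expn1; nia.
  by lia.
have up : avg_dag_nodes R m n <= 1 + ntrees R m K + n.+1%:R * ncb R K.
  rewrite avg_dag_nodesE ler_pdivrMr // mulrC; apply: sum_dag_le => //; lia.
have lo : n.+1%:R * (ncb R K - ncb R n./2 - nct R K) <= avg_dag_nodes R m n.
  rewrite avg_dag_nodesE ler_pdivlMr // mulrC; apply: sum_dag_ge => //; lia.
have cK : nct R K <= ncb R K / K%:R.
  rewrite ler_pdivlMr ?ltr0n // -mul_nct mulrC ler_pM2r ?nct_gt0 //.
  by rewrite ler_nat.
have tK : ntrees R m K <= m%:R * n%:R * (ncb R K / K%:R).
  rewrite ntreesE; apply: ler_pM; rewrite ?(ltW (nct_gt0 _ _)) ?mulr_ge0 ?exprn_ge0 ?mulr_ge0 //.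
  by rewrite ler_wpM2l.
have bL := ncb_half_le K n K0 Kn4.
have b1 : ncb R K <= 1 by rewrite -(ncb0 R) ncb_nonincreasing.
(* Absorbs the additive [1 + ncb R K] of the upper bound. *)
have half : 2 <= 4 * n%:R * (ncb R K / K%:R).
  have h := ncb_ge_half K K0.
  have K2 : K%:R ^+ 2 <= n%:R :> R.
    by rewrite -natrX ler_nat; apply: leq_trans K3n; rewrite leq_pexp2l.
  rewrite mulrA ler_pdivlMr ?ltr0n //.
  have : 2^-1 * (4 * n%:R) <= K%:R * ncb R K * (4 * n%:R) by rewrite ler_wpM2r // mulr_ge0.
  have : 2 * K%:R * K%:R <= 2 * n%:R :> R by move: K2; rewrite expr2; lra.
  move=> h1 h2; rewrite -(@ler_pM2r _ K%:R) ?ltr0n //; lra.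
have E : (m%:R + 8) / K%:R * (n%:R * ncb R K) = (m%:R + 8) * n%:R * (ncb R K / K%:R).
  by ring.
rewrite ler_norml; apply/andP; split.
  rewrite -lerBlDr opprK ler_pdivlMr // mulrDl mulNr E mul1r.
  apply: le_trans lo; rewrite -natr1.
  have y0 : 0 < ncb R K / K%:R by rewrite divr_gt0 // ltr0n.
  have s0 : 0 <= ncb R n./2 + nct R K by rewrite addr_ge0 // ltW ?ncb_gt0 ?nct_gt0.
  have s1 : ncb R n./2 + nct R K <= 4 * (ncb R K / K%:R) by move: bL cK; lra.
  move: s0 s1; set s := _ + _ => s0 s1; set y := _ / _ in s1 y0 *.
  have h1 : (n%:R + 1) * s <= (2 * n%:R) * s by rewrite ler_wpM2r //; lra.
  have h2 : 2 * n%:R * s <= 2 * n%:R * (4 * y) by rewrite ler_wpM2l.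
  have h3 : 0 <= m%:R * n%:R * y by rewrite !mulr_ge0 // ltW.
  have -> : ncb R K - ncb R n./2 - nct R K = ncb R K - s by rewrite /s; ring.
  by lra.
rewrite lerBlDr ler_pdivrMr // mulrDl E mul1r.
apply: le_trans up _; rewrite -natr1.
have h4 : 0 <= n%:R * (ncb R K / K%:R) by move: half; lra.
by move: tK half; lra.
Qed.

(** Squares are compared: that of [ncb R K] lies between 1/(pi(K+1/2)) and 1/(pi K) by Wallis, that
    of the target between 1/(pi(K+1)) and 1/(pi K) by the choice of [K]. *)
Lemma ncb_near (K n : nat) : (0 < K)%N -> ((4 * m) ^ K <= n <= (4 * m) ^ K.+1)%N ->
  `|ncb R K / (kappa R m / Num.sqrt (ln n%:R)) - 1| <= K%:R^-1.
Proof.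
move=> K0 /andP[Kn nK].
have K1 : 1 <= K%:R :> R by rewrite ler1n.
have n0 : (0 < n)%N by apply: leq_trans Kn; rewrite expn_gt0 muln_gt0 hm.
have q1 : 1 < q by rewrite -natrM ltr1n; lia.
have l0 : 0 < ln q by rewrite ln_gt0.
have qK : K%:R * ln q <= ln n%:R.
  rewrite mulr_natl -lnXn ?ler_ln ?posrE ?exprn_gt0 ?ltr0n ?(lt_trans ltr01) //.
  by rewrite -natrM -natrX ler_nat.
have nq : ln n%:R <= (K%:R + 1) * ln q.
  rewrite natr1 mulr_natl -lnXn ?ler_ln ?posrE ?exprn_gt0 ?ltr0n ?(lt_trans ltr01) //.
  by rewrite -natrM -natrX ler_nat.
have [p0 b0] := (pi_gt0 R, ncb_gt0 R K).
have ln0 : 0 < ln n%:R :> R by apply: lt_le_trans qK; rewrite mulr_gt0 // ltr0n.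
set D := kappa R m / Num.sqrt (ln n%:R).
have D0 : 0 < D by rewrite divr_gt0 // sqrtr_gt0 // divr_gt0.
have D2 : D ^+ 2 = ln q / (pi * ln n%:R).
  rewrite exprMn exprVn !sqr_sqrtr ?divr_ge0 ?(ltW l0) ?(ltW p0) ?(ltW ln0) //.
  by rewrite invfM mulrA.
have D2le : D ^+ 2 <= (pi * K%:R)^-1.
  rewrite D2 ler_pdivrMr ?mulr_gt0 // [leRHS]mulrC ler_pdivlMr ?mulr_gt0 ?ltr0n //.
  by rewrite [leLHS]mulrCA ler_pM2l // [leLHS]mulrC.
have D2ge : (pi * (K%:R + 1))^-1 <= D ^+ 2.
  rewrite D2 ler_pdivlMr ?mulr_gt0 // [leLHS]mulrC ler_pdivrMr.
    by rewrite [leRHS]mulrCA ler_pM2l // [leRHS]mulrC.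
  by rewrite mulr_gt0 //; lra.
have Wl := ncb_ge R K.
have Wu : ncb R K ^+ 2 <= (pi * K%:R)^-1 by rewrite -(prednK K0); exact: ncb_le.
have x0 : 0 < K%:R^-1 :> R by rewrite invr_gt0 ltr0n.
have x1 : K%:R^-1 <= 1 :> R by rewrite invf_le1 // ltr0n.
have Kn0 : K%:R != 0 :> R by rewrite pnatr_eq0 -lt0n.
rewrite ler_norml; apply/andP; split.
  rewrite -lerBlDr opprK ler_pdivlMr // -(@ler_pXn2r _ 2) ?nnegrE ?(ltW b0) //; last first.
    by rewrite mulr_ge0 ?(ltW D0) //; lra.
  apply: le_trans Wl; rewrite exprMn.
  (* One of the two factors 1 - 1/K is bounded by 1; the other suffices because (1 - x)(1 + x/2) is
     at most 1 for x = 1/K. *)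
  apply: (@le_trans _ _ ((- K%:R^-1 + 1) * (pi * K%:R)^-1)).
    by apply: ler_pM; rewrite ?sqr_ge0 //; nra.
  rewrite -[leRHS]div1r ler_pdivlMr; last by rewrite mulr_gt0 //; lra.
  rewrite [leLHS](_ : _ = (1 - K%:R^-1) * (1 + K%:R^-1 / 2)); first by nra.
  by move: (pi : R) p0 => p p0; field; rewrite Kn0 gt_eqF.
rewrite lerBlDr ler_pdivrMr // -(@ler_pXn2r _ 2) ?nnegrE ?(ltW b0) //; last first.
  by rewrite mulr_ge0 ?(ltW D0) //; lra.
apply: le_trans Wu _; rewrite exprMn.
(* An equality, since (1 + 1/K)/(K + 1) = 1/K. *)
apply: (@le_trans _ _ ((K%:R^-1 + 1) * (pi * (K%:R + 1))^-1)).
  rewrite le_eqVlt; apply/orP; left; apply/eqP; move: (pi : R) p0 => p p0; field.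
  by rewrite natr1 pnatr_eq0 Kn0 (gt_eqF p0).
have y0 : 0 <= (pi * (K%:R + 1))^-1 :> R by rewrite invr_ge0 mulr_ge0 ?(ltW p0) //; lra.
by apply: ler_pM => //; nra.
Qed.

(** Since [y <= 1], the factor [b] has absolute value at most 2. *)
Lemma normrM_sub1_le (a b x y : R) : `|a - 1| <= x -> `|b - 1| <= y -> y <= 1 ->
  `|a * b - 1| <= 2 * x + y.
Proof.
move=> ax bx y1; rewrite (_ : a * b - 1 = (a - 1) * b + (b - 1)); last by ring.
apply: le_trans (ler_normD _ _) (lerD _ bx); rewrite normrM mulrC.
apply: ler_pM => //; have := ler_normD (b - 1) 1.
by rewrite subrK normr1 => /le_trans; apply; lra.
Qed.

End Asymptotics.

(* Nbar_{m,n} = kappa_m * n / sqrt(ln n) * (1 + O(1/ln n)) as n -> oo *)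
Theorem theorem9 (R : realType) (m : nat) (hm : (1 <= m)%N) :
  exists C : R, exists N : nat, forall n : nat, (N <= n)%N ->
    `| avg_dag_nodes R m n / (kappa R m * n%:R / Num.sqrt (ln n%:R)) - 1 |
      <= C / ln n%:R.
Proof.
(* The first factor is the constant that [normrM_sub1_le] yields in front of 1/K. The second
   converts 1/K into 1/ln n, as ln n is at most (K + 1) ln(4m), hence at most 2K ln(4m). The
   threshold [4 * m] ensures that [K] is positive. *)
exists ((2 * (m%:R + 8) + 1) * (2 * ln (4 * m%:R))), (4 * m)%N => n Nn.
have q1 : (1 < 4 * m)%N by lia.
have n0 : (0 < n)%N by lia.
pose K := trunc_log (4 * m) n.
have nK : (n < (4 * m) ^ K.+1)%N by exact: trunc_log_ltn.
have Kb : ((4 * m) ^ K <= n <= (4 * m) ^ K.+1)%N by rewrite trunc_logP // ltnW.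
have K0 : (0 < K)%N by rewrite trunc_log_gt0 q1 /=; lia.
have K1 : 1 <= K%:R :> R by rewrite ler1n.
have near1 := avg_dag_near R m hm K n K0 Kb.
have near2 := ncb_near R m hm K n K0 Kb.
have b0 := ncb_gt0 R K.
have n0' : 0 < n%:R :> R by rewrite ltr0n.
have l0 : 0 < ln (4 * m%:R : R) by rewrite ln_gt0 // -natrM ltr1n.
have ln0 : 0 < ln n%:R :> R by rewrite ln_gt0 // ltr1n; lia.
have ln_le : ln n%:R <= K.+1%:R * ln (4 * m%:R : R).
  rewrite mulr_natl -lnXn; last by rewrite -natrM ltr0n; lia.
  by rewrite ler_ln ?posrE ?exprn_gt0 // -natrM ?ltr0n -?natrX ?ler_nat ?(ltnW nK) //; lia.
have kap0 : 0 < kappa R m by rewrite sqrtr_gt0 divr_gt0 // pi_gt0.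
have s0 : 0 < Num.sqrt (ln n%:R) :> R by rewrite sqrtr_gt0.
have -> : avg_dag_nodes R m n / (kappa R m * n%:R / Num.sqrt (ln n%:R)) =
    avg_dag_nodes R m n / (n%:R * ncb R K) * (ncb R K / (kappa R m / Num.sqrt (ln n%:R))).
  by field; rewrite !gt_eqF.
apply: le_trans (normrM_sub1_le _ _ _ _ _ near1 near2 _) _.
  by rewrite invf_le1 // ltr0n.
rewrite [leLHS](_ : _ = (2 * (m%:R + 8) + 1) * K%:R^-1); last by ring.
rewrite -mulrA ler_wpM2l //.
rewrite ler_pdivlMr // [leLHS]mulrC ler_pdivrMr ?ltr0n //; apply: le_trans ln_le _.
by rewrite mulrAC ler_pM2r // -natr1; lra.
Qed.
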